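(* Let $\mathcal{R}$ be a class of groups (closed under isomorphism) such that every fully residually $\mathcal{R}$ group belongs to $\mathcal{R}$. Then both of the following hold. (Extension version) Suppose that every group $E$ fitting into a short exact sequence $1\to N\to E\to Q'\to 1$ with $N$ finite and $Q'\in\mathcal{R}$ belongs to $\mathcal{R}$. If $1\to K\to G\to Q\to 1$ is a short exact sequence of groups with $K$ finitely generated and residually finite and $Q\in\mathcal{R}$, then $G\in\mathcal{R}$. (Split version) Suppose that every group $E$ fitting into a split short exact sequence $1\to N\to E\to Q'\to 1$ with $N$ finite and $Q'\in\mathcal{R}$ belongs to $\mathcal{R}$. If $1\to K\to G\to Q\to 1$ is a split short exact sequence of groups with $K$ finitely generated and residually finite and $Q\in\mathcal{R}$, then $G\in\mathcal{R}$.
   Context: A group $G$ is fully residually $\mathcal{R}$ if for every finite subset $S\subseteq G$ there exist a group $H\in\mathcal{R}$ and a surjective homomorphism $G\to H$ whose restriction to $S$ is injective. A short exact sequence $1\to K\to G\to Q\to 1$ is split if the quotient homomorphism $G\to Q$ admits a section that is a group homomorphism (equivalently, $G$ is a semidirect product $K\rtimes Q$). *)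

(* Defs.v *)
(* Groups, possibly infinite, are inhabitants of groupType; its choiceType
   component is no restriction, as every type carries such a structure under the
   classical axioms of mathcomp.classical.boolp. *)
From HB Require Import structures.
From mathcomp Require Import all_boot.
From mathcomp Require Import boolp classical_sets functions cardinality.

Set Implicit Arguments.
Unset Strict Implicit.
Unset Printing Implicit Defensive.

Local Open Scope classical_set_scope.
Local Open Scope group_scope.

(* Homomorphisms: maps preserving the product and the unit, the structure for which
   the library states gmulfV, gmulfJ, etc. *)
Notation group_hom G H := (UMagmaMorphism.type G H).

Definition isomorphic_groups (G H : groupType) : Prop :=
  exists f : group_hom G H, bijective f.

Definition finite_group (G : groupType) : Prop := finite_set [set: G].

Definition subgroup (G : groupType) (A : set G) : Prop :=
  group_closed (mem A).

Definition finitely_generated (G : groupType) : Prop :=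
  exists2 S : set G, finite_set S & smallest (@subgroup G) S = [set: G].

Definition residually_finite (G : groupType) : Prop :=
  forall g : G, g <> 1 ->
    exists (F : groupType) (f : group_hom G F),
      finite_group F /\ f g <> 1.

Definition fully_residually (R : groupType -> Prop) (G : groupType) : Prop :=
  forall S : set G, finite_set S ->
    exists (H : groupType) (f : group_hom G H),
      [/\ R H, range f = [set: H] & {in S &, injective f}].

Definition short_exact (K G Q : groupType)
    (i : group_hom K G) (p : group_hom G Q) : Prop :=
  [/\ injective i, range i = p @^-1` [set 1] & range p = [set: Q]].

Definition split_short_exact (K G Q : groupType)
    (i : group_hom K G) (p : group_hom G Q) : Prop :=
  short_exact i p /\ exists s : group_hom Q G, cancel s p.

(* Main.v *)
(* Given a finite subset S of G, residual finiteness yields a finite group F and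
   a homomorphism K -> F that is nontrivial on every nontrivial element of K of
   the form s / t with s, t in S.  The intersection M of the kernels of all
   homomorphisms K -> F is characteristic in K, and K / M is finite because the
   finitely generated group K has only finitely many homomorphisms to F.  Hence
   M is normal in G, the group G / M is an extension of Q by the finite group
   K / M, split if G is, and G -> G / M is injective on S. *)
Require Import Defs.
From HB Require Import structures.
From mathcomp Require Import all_boot generic_quotient.
From mathcomp Require Import boolp classical_sets functions cardinality.

Set Implicit Arguments.
Unset Strict Implicit.
Unset Printing Implicit Defensive.

Local Open Scope classical_set_scope.
Local Open Scope group_scope.

(** * Quotients of possibly infinite groups by normal subgroups *)

Definition normal_subgroup (G : groupType) (N : set G) : Prop :=
  subgroup N /\ forall x y, N x -> N (x ^ y).

Section QuotientGroup.
Local Open Scope quotient_scope.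
Variables (G : groupType) (N : set G) (nN : normal_subgroup N).

Let N1 : N 1.
Proof. by case: nN => [[+ _] _]; rewrite inE. Qed.

Let NF x y : N x -> N y -> N (x / y).
Proof. by case: nN => [[_ h] _] Nx Ny; have := h x y; rewrite !inE; apply. Qed.

Let NV x : N x -> N x^-1.
Proof. by move=> Nx; rewrite -div1g; exact: NF. Qed.

Let NM x y : N x -> N y -> N (x * y).
Proof. by move=> Nx /NV Ny; rewrite -[y]invgK; exact: NF. Qed.

Let NJ x y : N x -> N (x ^ y).
Proof. by case: nN => _; apply. Qed.

Definition cosetb (x y : G) : bool := `[< N (x / y) >].

Lemma cosetb_refl : reflexive cosetb.
Proof. by move=> x; apply/asboolP; rewrite divgg. Qed.

Lemma cosetb_sym : symmetric cosetb.
Proof.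
by move=> x y; apply/asboolP/asboolP => /NV; rewrite invgF.
Qed.

Lemma cosetb_trans : transitive cosetb.
Proof.
move=> y x z /asboolP xy /asboolP yz; apply/asboolP.
by have := NM xy yz; rewrite mulgA mulgVK.
Qed.

Canonical cosetb_equiv := EquivRel cosetb cosetb_refl cosetb_sym cosetb_trans.

Definition quotient_group := {eq_quot cosetb}.
HB.instance Definition _ := Choice.on quotient_group.

Definition coset_map (x : G) : quotient_group := \pi x.

Lemma coset_mapP x y : coset_map x = coset_map y <-> N (x / y).
Proof.
by rewrite (rwP eqP) eqmodE -(rwP (asboolP _)).
Qed.

Let R (u : quotient_group) : G := repr u.

Lemma repr_cosetK u : coset_map (R u) = u.
Proof. exact: reprK. Qed.

Definition coset_mul u v : quotient_group := coset_map (R u * R v).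
Definition coset_inv u : quotient_group := coset_map (R u)^-1.

Lemma coset_mapM x y :
  coset_map (x * y) = coset_mul (coset_map x) (coset_map y).
Proof.
apply/coset_mapP.
set x' := R (coset_map x); set y' := R (coset_map y).
have xx' : N (x / x') by apply/coset_mapP; rewrite repr_cosetK.
have yy' : N (y / y') by apply/coset_mapP; rewrite repr_cosetK.
(* Normality puts the first factor in [N], so the class of a product does not depend on the chosen
   representatives. *)
have -> : x * y / (x' * y') = (y / y') ^ x^-1 * (x / x').
  by rewrite /conjg invgM invgK !mulgA mulgVK.
exact/NM/xx'/NJ.
Qed.

Lemma coset_mapV x : coset_map x^-1 = coset_inv (coset_map x).
Proof.
apply/coset_mapP; set x' := R (coset_map x); rewrite invgK.
have xx' : N (x' / x) by apply/coset_mapP; rewrite repr_cosetK.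
have -> : x^-1 * x' = (x' / x) ^ x by rewrite /conjg mulgVK.
exact: NJ.
Qed.

(** Every class is the image of its representative, so each group law is carried over from [G] along
    [coset_map]. *)
Lemma coset_mulA : associative coset_mul.
Proof.
move=> u v w; rewrite -(repr_cosetK u) -(repr_cosetK v) -(repr_cosetK w).
by rewrite -!coset_mapM mulgA.
Qed.

Lemma coset_mul1g : left_id (coset_map 1) coset_mul.
Proof. by move=> u; rewrite -(repr_cosetK u) -coset_mapM mul1g. Qed.

Lemma coset_mulg1 : right_id (coset_map 1) coset_mul.
Proof. by move=> u; rewrite -(repr_cosetK u) -coset_mapM mulg1. Qed.

Lemma coset_mulVg : left_inverse (coset_map 1) coset_inv coset_mul.
Proof.
by move=> u; rewrite -(repr_cosetK u) -coset_mapV -coset_mapM mulVg.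
Qed.

Lemma coset_mulgV : right_inverse (coset_map 1) coset_inv coset_mul.
Proof.
by move=> u; rewrite -(repr_cosetK u) -coset_mapV -coset_mapM mulgV.
Qed.

HB.instance Definition _ :=
  isGroup.Build quotient_group coset_mulA coset_mul1g coset_mulg1
    coset_mulVg coset_mulgV.

HB.instance Definition _ :=
  isMultiplicative.Build G quotient_group coset_map coset_mapM.
HB.instance Definition _ :=
  Multiplicative_isUMagmaMorphism.Build G quotient_group coset_map erefl.

End QuotientGroup.

(** Hides the construction: what follows uses only a surjection with kernel [N]. *)
Lemma quotient_group_exists (G : groupType) (N : set G) :
  normal_subgroup N -> exists (H : groupType) (q : group_hom G H),
    range q = [set: H] /\ forall x, q x = 1 <-> N x.
Proof.
move=> nN; exists (quotient_group nN), (@coset_map _ _ nN : group_hom _ _).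
split.
  by apply/seteqP; split=> // u _; exists (repr u); [|exact: repr_cosetK].
by move=> x; rewrite coset_mapP divg1.
Qed.

(** * Building homomorphisms and factoring them through surjections *)

Lemma morph_group_hom (G H : groupType) (f : G -> H) :
  {morph f : x y / x * y} -> exists h : group_hom G H, h =1 f.
Proof.
move=> fM.
have fF : {morph f : x y / x / y}.
  by move=> x y; apply: (@mulIg _ (f y)); rewrite -fM !mulgVK.
pose m := isGroupMorphism.Build G H f fF.
pose h : group_hom G H := HB.pack f m.
by exists h.
Qed.

Lemma hom_eqP (G H : groupType) (f : group_hom G H) x y :
  f x = f y <-> f (x / y) = 1.
Proof.
rewrite gmulfF; split=> [->|e]; first exact: mulgV.
by apply: (@mulIg _ (f y)^-1); rewrite mulgV.
Qed.

Lemma hom_factor (G H L : groupType) (q : group_hom G H) (g : group_hom G L) :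
  range q = [set: H] -> (forall x, q x = 1 -> g x = 1) ->
  exists h : group_hom H L, forall x, h (q x) = g x.
Proof.
move=> qsurj qg.
(* [xget] picks a preimage under [q]; its default 1 is never reached, as [q] is onto. *)
have sP u : q (xget 1 [set x | q x = u]) = u.
  have : range q u by rewrite qsurj.
  by case=> x _ qx; apply: (xgetPex 1 (P := [set x | q x = u])); exists x.
have key x y : q x = q y -> g x = g y.
  by move=> /hom_eqP/qg/hom_eqP.
have [|h hE] := @morph_group_hom H L (fun u => g (xget 1 [set x | q x = u])).
  by move=> u v; rewrite -gmulfM; apply: key; rewrite gmulfM !sP.
by exists h => x; rewrite hE; apply: key; rewrite sP.
Qed.

(** * Homomorphisms to a finite group and their common kernel *)

Lemma finite_set_seqs (T : choiceType) (n : nat) :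
  finite_set [set: T] -> finite_set [set l : seq T | size l = n].
Proof.
move=> finT; elim: n => [|n IHn].
  by apply: (sub_finite_set _ (finite_set1 [::])) => l /size0nil.
apply: (sub_finite_set _
  (finite_image (fun u : T * seq T => u.1 :: u.2) (finite_setX finT IHn))).
by case=> // a l /= [sl]; exists (a, l).
Qed.

(** The map [q] factors through [e], so its range is the image of [range e] under a choice of
    preimages. *)
Lemma finite_range_factor (T U V : Type) (e : T -> U) (q : T -> V) :
  finite_set (range e) -> (forall x y, e x = e y -> q x = q y) ->
  finite_set (range q).
Proof.
move=> fe eq; have [[t _]|T0] := pselect ([set: T] !=set0); last first.
  by apply: (sub_finite_set _ (finite_set0 _)) => v [x]; case: T0; exists x.
(* [xget] needs a choice structure on [T], and [t] as default. *)
elim/Pchoice: T => T in e q fe eq t *.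
apply: (sub_finite_set _
  (finite_image (fun u => q (xget t [set x | e x = u])) fe)).
move=> _ [x _ <-]; exists (e x) => //.
by apply: eq; apply: (xgetPex t (P := [set y | e y = e x])); exists x.
Qed.

(** A homomorphism is determined by the sequence of its values on the generators. Counting
    underlying functions makes pointwise equality enough. *)
Lemma finite_homs (K F : groupType) : finitely_generated K -> finite_group F ->
  finite_set (range (fun f : group_hom K F => f : K -> F)).
Proof.
move=> [S /finite_seqP[s ->] gen] finF.
apply: (@finite_range_factor _ _ _ (fun f : group_hom K F => map f s)).
  apply: (sub_finite_set _ (finite_set_seqs (size s) finF)).
  by move=> _ [f _ <-] /=; rewrite size_map.
move=> f g /eq_in_map fg; apply/funext => x.
have : [set: K] x by [].
(* The equalizer of [f] and [g] is a subgroup containing the generators. *)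
rewrite -gen; apply: (@smallest_sub _ _ _ [set x | f x = g x]) => /=.
- split; first by rewrite inE /= !gmulf1.
  by move=> u v; rewrite !inE /= !gmulfF => -> ->.
- by move=> y /fg.
Qed.

(** Taking all homomorphisms, not just one, makes this stable under every endomorphism of [K], as
    normality in [G] will require. *)
Definition hom_kernel (K F : groupType) : set K :=
  [set k | forall f : group_hom K F, f k = 1].

Lemma hom_kernel_subgroup (K F : groupType) : subgroup (@hom_kernel K F).
Proof.
split; first by rewrite inE => f; rewrite gmulf1.
by move=> u v; rewrite !inE => hu hv f; rewrite gmulfF hu hv divgg.
Qed.

Lemma hom_kernel_normal (K F : groupType) : normal_subgroup (@hom_kernel K F).
Proof.
split; first exact: hom_kernel_subgroup.
by move=> x y hx f; rewrite gmulfJ hx conj1g.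
Qed.

(** The class of [x] is determined by the values at [x] of the finitely many homomorphisms to
    [F]. *)
Lemma hom_kernel_finite_index (K F H : groupType) (q : group_hom K H) :
  finitely_generated K -> finite_group F ->
  (forall x, q x = 1 <-> @hom_kernel K F x) -> finite_set (range q).
Proof.
move=> fgK finF qE; have /finite_seqP[fs fsE] := finite_homs fgK finF.
apply: (@finite_range_factor _ _ _ (fun x => [seq f x | f <- fs])).
  apply: (sub_finite_set _ (finite_set_seqs (size fs) finF)).
  by move=> _ [x _ <-] /=; rewrite size_map.
move=> x y /eq_in_map xy; apply/hom_eqP/qE => f; apply/hom_eqP/xy.
by have : [set` fs] (f : K -> F) by rewrite -fsE; exists f.
Qed.

(** * Residual finiteness for finitely many elements at once *)

Lemma residually_finite_seq (K : groupType) (s : seq K) :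
  residually_finite K -> exists (F : groupType) (f : group_hom K F),
    finite_group F /\ forall k, k \in s -> k <> 1 -> f k <> 1.
Proof.
move=> rfK; elim: s => [|a s [F [f [finF fP]]]].
  (* Functions on the empty type form a trivial group. *)
  pose F : groupType := {ffun void -> K}.
  have F1 (u : F) : u = 1 by apply/ffunP => -[].
  have [|f _] := @morph_group_hom K F (fun=> 1).
    by move=> *; rewrite mulg1.
  exists F, f; split=> //.
  by apply: (sub_finite_set _ (finite_set1 (1 : F))) => u _; exact: F1.
have [->|/rfK [F' [f' [finF' f'a]]]] := pselect (a = 1).
  exists F, f; split=> // k; rewrite inE => /predU1P[-> //|]; exact: fP.
(* The product map detects [a] in one factor and the entries of [s] in the other. *)
have [|h hE] := @morph_group_hom K (F' * F)%type (fun x => (f' x, f x)).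
  by move=> x y; rewrite !gmulfM.
exists (F' * F)%type, h; split.
  by apply: (sub_finite_set _ (finite_setX finF' finF)) => -[].
move=> k; rewrite inE hE => /predU1P[-> _ [] //|ks k1 [_]]; exact: fP.
Qed.

(** * Quotients of an extension that make its kernel finite *)

Lemma hom_kernel_image_normal (K G Q F : groupType)
    (i : group_hom K G) (p : group_hom G Q) :
  short_exact i p -> normal_subgroup (i @` @hom_kernel K F).
Proof.
move=> [injI imI _]; split.
  have [+ hF] := hom_kernel_subgroup K F; rewrite inE => h1.
  split; first by rewrite inE; exists 1; rewrite ?gmulf1.
  move=> _ _ /set_mem[a ha <-] /set_mem[b hb <-]; rewrite inE.
  by exists (a / b); [apply/set_mem/hF; rewrite inE|rewrite gmulfF].
move=> _ g [k hk <-].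
(* The image of [i] is the kernel of [p], so conjugation by [g] restricts to a map of [K],
   multiplicative because [i] is injective. *)
have imJ x : exists y, i y = i x ^ g.
  have : range i (i x ^ g).
    rewrite imI /= gmulfJ.
    have : range i (i x) by exists x.
    by rewrite imI /= => ->; rewrite conj1g.
  by case=> y _ <-; exists y.
have [c cE] := choice imJ.
have [|h hE] := @morph_group_hom K K c.
  by move=> x y; apply: injI; rewrite gmulfM !cE gmulfM conjMg.
(* Precomposing [f] with this endomorphism gives another homomorphism to [F], which kills [k]. *)
by exists (c k); [move=> f; rewrite -hE; exact: (hk (f \o h))|rewrite cE].
Qed.

(** The equation [r (q x) = p x] serves the split case: it turns a section [s] of [p] into the
    section [q \o s] of [r]. *)
Lemma finite_kernel_quotient (K G Q : groupType)
    (i : group_hom K G) (p : group_hom G Q) (S : set G) :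
  short_exact i p -> finitely_generated K -> residually_finite K ->
  finite_set S ->
  exists (N H : groupType) (j : group_hom N H) (r : group_hom H Q)
    (q : group_hom G H),
    [/\ short_exact j r, finite_group N, range q = [set: H],
        forall x, r (q x) = p x & {in S &, injective q}].
Proof.
move=> ex fgK rfK finS; have [injI imI surP] := ex.
pose D := [set k | exists st, (S `*` S) st /\ i k = st.1 / st.2].
(* Injectivity of [i] bounds [D] by the finitely many quotients of elements of [S]. *)
have /finite_seqP[d dE] : finite_set D.
  apply: (@sub_finite_set _ _
    (i @^-1` ((fun st => st.1 / st.2) @` (S `*` S)))); last first.
    apply: finite_preimage; last exact/finite_image/finite_setX.
    by move=> ? ? _ _; exact: injI.
  by move=> k [st [Sst ik]]; exists st.
have [F [f [finF fP]]] := residually_finite_seq d rfK.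
have [N [qK [surK kerK]]] := quotient_group_exists (hom_kernel_normal K F).
have [H [q [surq kerq]]] :=
  quotient_group_exists (hom_kernel_image_normal F ex).
have [|j jE] := @hom_factor K N H qK (q \o i) surK.
  by move=> x /kerK hx; apply/kerq; exists x.
have pi1 x : p (i x) = 1.
  have : range i (i x) by exists x.
  by rewrite imI.
have [|r rE] := @hom_factor G H Q q p surq.
  by move=> x /kerq[k _ <-].
exists N, H, j, r, q; split=> //.
- split.
  (* If [j] kills the class of [k], then [i k] lies in the image of [hom_kernel], hence [k] is in
     [hom_kernel] as [i] is injective. *)
  + apply: gmulf_inj => u; have [k _ <-] : range qK u by rewrite surK.
    by rewrite jE => /kerq[k' hk' /injI kk']; apply/kerK; rewrite -kk'.
  + apply/seteqP; split=> [_ [u _ <-]|v] /=.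
      have [k _ <-] : range qK u by rewrite surK.
      by rewrite jE /= rE.
    have [g _ <-] : range q v by rewrite surq.
    rewrite rE => pg; have [k _ <-] : range i g by rewrite imI.
    by exists (qK k); rewrite // jE.
  + apply/seteqP; split=> // u _; have [g _ <-] : range p u by rewrite surP.
    by exists (q g).
- rewrite /finite_group -surK.
  exact: hom_kernel_finite_index fgK finF kerK.
move=> x y; rewrite !inE => Sx Sy qxy.
(* Here [x / y] is [i k] with [k] killed by every homomorphism to [F], in particular by [f], which
   is nontrivial on the nontrivial entries of [d]. *)
have /kerq[k hk ik] : q (x / y) = 1 by apply/hom_eqP.
have kd : k \in d.
  by have : [set` d] k by rewrite -dE; exists (x, y).
have k1 : k = 1 by apply: contrapT => /(fP _ kd); apply; exact: hk.
by apply: (@mulIg _ y^-1); rewrite mulgV -ik k1 gmulf1.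
Qed.

Theorem theorem1 (R : groupType -> Prop)
    (R_iso : forall G H : groupType, isomorphic_groups G H -> R G -> R H)
    (R_closed : forall G : groupType, fully_residually R G -> R G) :
  ((forall (N E Q' : groupType)
       (i : group_hom N E) (p : group_hom E Q'),
       short_exact i p -> finite_group N -> R Q' -> R E) ->
   forall (K G Q : groupType)
     (i : group_hom K G) (p : group_hom G Q),
     short_exact i p -> finitely_generated K -> residually_finite K ->
     R Q -> R G)
  /\
  ((forall (N E Q' : groupType)
       (i : group_hom N E) (p : group_hom E Q'),
       split_short_exact i p -> finite_group N -> R Q' -> R E) ->
   forall (K G Q : groupType)
     (i : group_hom K G) (p : group_hom G Q),
     split_short_exact i p -> finitely_generated K -> residually_finite K ->
     R Q -> R G).
Proof.
split=> R_ext K G Q i p.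
  move=> ex fgK rfK RQ; apply: R_closed => S finS.
  have [N [H [j [r [q [exjr finN surq _ injq]]]]]] :=
    finite_kernel_quotient ex fgK rfK finS.
  by exists H, q; split=> //; exact: R_ext exjr finN RQ.
move=> [ex [s sK]] fgK rfK RQ; apply: R_closed => S finS.
have [N [H [j [r [q [exjr finN surq rq injq]]]]]] :=
  finite_kernel_quotient ex fgK rfK finS.
exists H, q; split=> //; apply: R_ext finN RQ; split; first exact: exjr.
by exists (q \o s) => x /=; rewrite rq.
Qed.
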